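(* Let $S$ be a set of $n\ge 4$ points in general position in the plane, exactly $h$ of which lie on the boundary of the convex hull of $S$. Then $p_E(z)=\sum_{k=0}^{n-3} E_{\le k} z^k$ has a root of modulus at least \[ \left(\frac{3\binom{n}{3}}{h}\right)^{-\frac{1}{n-3}}. \]
   Context: General position means no three points of $S$ are collinear and no four points of $S$ are cocircular. A $j$-edge of $S$ is a directed line through two points of $S$ such that the open half-plane to its right contains exactly $j$ points of $S$; $e_j$ is their number and $E_{\le k}=\sum_{j=0}^k e_j$. *)

(* Defs.v *)
(* MathComp and MathComp-Analysis (plane over an arbitrary realType). *)
From mathcomp Require Export all_boot all_order all_algebra finmap.
From mathcomp Require Export all_classical all_reals all_analysis.
From mathcomp Require Export complex.

Set Implicit Arguments.
Unset Strict Implicit.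
Unset Printing Implicit Defensive.

Export Order.TTheory GRing.Theory Num.Theory.
Export numFieldNormedType.Exports.

Local Open Scope classical_set_scope.
Local Open Scope ring_scope.

Notation plane R := 'rV[R]_2.

Section PlaneGeometry.
Variable R : realType.
Implicit Types (p q r c a d : plane R) (A T S : {fset plane R}).

(* The library norm on row vectors is the sup norm, hence this separate
   Euclidean distance. *)
Definition sqdist p q : R := \sum_(i < 2) (p 0 i - q 0 i) ^+ 2.

Definition collinear A : Prop :=
  exists a d, d != 0 /\ forall p, p \in A -> exists t : R, p = a + t *: d.

Definition cocircular A : Prop :=
  exists c (rho : R), 0 < rho /\ forall p, p \in A -> sqdist p c = rho ^+ 2.

Definition general_position S : Prop :=
  (forall T, (T `<=` S)%fset -> #|` T| = 3 -> ~ collinear T) /\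
  (forall T, (T `<=` S)%fset -> #|` T| = 4 -> ~ cocircular T).

Definition convex_hull (A : set (plane R)) : set (plane R) :=
  smallest (@convex_set R (plane R)) A.

Definition boundary (A : set (plane R)) : set (plane R) := closure A `\` A°.

Definition num_hull_points S : nat :=
  #|` [fset p in S | p \in boundary (convex_hull [set` S])]%fset|.

(* Twice the signed area of the triangle p q r: positive iff the triangle is
   counterclockwise. *)
Definition orient p q r : R :=
  (q 0 0 - p 0 0) * (r 0 1 - p 0 1) - (q 0 1 - p 0 1) * (r 0 0 - p 0 0).

(* Membership of r in the open half-plane to the right of the line through p
   and q directed from p to q. *)
Definition right_of p q r : bool := orient p q r < 0.

(* A directed line through two points of S is represented by the ordered pair
   of these points, in the order in which the line meets them; it determines
   the pair when no three points of S are collinear. *)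
Definition is_jedge S (j : nat) (l : plane R * plane R) : bool :=
  [&& l.1 \in S, l.2 \in S, l.1 != l.2 &
      #|` [fset r in S | right_of l.1 l.2 r]%fset| == j].

Definition num_jedges S (j : nat) : nat :=
  #|` [fset l in (S `*` S)%fset | is_jedge S j l]%fset|.

Definition num_le_kedges S (k : nat) : nat :=
  (\sum_(j < k.+1) num_jedges S j)%N.

Definition edge_poly S : {poly R[i]} :=
  \poly_(k < (#|` S| - 3).+1) (num_le_kedges S k)%:R.

End PlaneGeometry.

(* Main.v *)
(* The product of the moduli of the roots of p_E is E_0 / E_{<= n-3}, so some
   root has modulus at least its (n-3)-th root.  Summing over all ordered pairs,
   E_{<= n-3} <= n(n-1) <= 3 'C(n, 3).  Moreover E_0 >= h: if p in S starts no
   0-edge, pick a in S, and let b be the last point of S met when rotating the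
   ray pa clockwise through less than a half-turn; some c in S lies to the right
   of pb, hence to the left of pa, so p is interior to the triangle abc. *)
Require Import Defs.
From mathcomp Require Import ring lra zify.

Set Implicit Arguments.
Unset Strict Implicit.
Unset Printing Implicit Defensive.

Local Open Scope classical_set_scope.
Local Open Scope ring_scope.
Local Open Scope complex_scope.

(** * Convexity, orientation and 0-edges at hull points *)

Section HullEdges.
Variable R : realType.
Implicit Types (p q r a b c x y : plane R) (S : {fset plane R}).

Lemma row2P x y : x 0 0 = y 0 0 -> x 0 1 = y 0 1 -> x = y.
Proof.
move=> h0 h1; apply/rowP => i; case: (unliftP 0 i) => [j ->|-> //].
by rewrite (ord1 j); have -> : lift 0 0 = 1 :> 'I_2 by apply: val_inj.
Qed.

Lemma sqr_coords_gt0 x y :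
  x != y -> 0 < (y 0 0 - x 0 0) ^+ 2 + (y 0 1 - x 0 1) ^+ 2.
Proof.
apply: contraNT; rewrite lt_neqAle addr_ge0 ?sqr_ge0 // andbT negbK eq_sym.
rewrite paddr_eq0 ?sqr_ge0 // !sqrf_eq0 !subr_eq0 => /andP[/eqP e0 /eqP e1].
by apply/eqP/row2P.
Qed.

Lemma convex_set_weighted (C : set (plane R)) x y (u v : R) :
  convex_set (M := plane R) C -> C x -> C y -> 0 < u -> 0 < v ->
  C ((u / (u + v)) *: x + (v / (u + v)) *: y).
Proof.
move=> cC /mem_set xC /mem_set yC u0 v0; have uv0 : 0 < u + v by lra.
have t0 : 0 <= u / (u + v) by rewrite divr_ge0 //; lra.
have t1 : u / (u + v) <= 1 by rewrite ler_pdivrMr //; lra.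
have -> : v / (u + v) = 1 - u / (u + v) by field; exact: lt0r_neq0.
exact: set_mem (cC x y (Itv01 t0 t1) xC yC).
Qed.

Lemma triangle_sub_convex (C : set (plane R)) a b c x :
  convex_set (M := plane R) C -> C a -> C b -> C c ->
  orient x a b < 0 -> orient x b c < 0 -> orient x c a < 0 -> C x.
Proof.
move=> cC Ca Cb Cc; rewrite -!oppr_gt0.
(* The barycentric coordinates of x are proportional to wa, wb, wc. *)
set wc := - orient x a b; set wa := - orient x b c; set wb := - orient x c a.
move=> wc0 wa0 wb0; have wbc0 : 0 < wb + wc by lra.
have wabc0 : 0 < wa + (wb + wc) by lra.
(* Two binary combinations suffice: a point of the segment [b c], then its combination with [a]. *)
have Cy := convex_set_weighted cC Cb Cc wb0 wc0.
suff -> : x = (wa / (wa + (wb + wc))) *: a + ((wb + wc) / (wa + (wb + wc))) *: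
    ((wb / (wb + wc)) *: b + (wc / (wb + wc)) *: c).
  exact: convex_set_weighted.
have bary i : i = 0 \/ i = 1 ->
    x 0 i * (wa + (wb + wc)) = wa * a 0 i + wb * b 0 i + wc * c 0 i.
  by case=> ->; rewrite /wa /wb /wc /orient; ring.
apply: row2P; rewrite !mxE; apply: (mulIf (lt0r_neq0 wabc0)).
  by rewrite bary; [field; rewrite !lt0r_neq0 | left].
by rewrite bary; [field; rewrite !lt0r_neq0 | right].
Qed.

Lemma orient_continuous a b : continuous (fun x => orient x a b).
Proof.
have cc i : continuous (fun x : plane R => x 0 i : R) by exact: coord_continuous.
have cB (u : R) i : continuous (fun x : plane R => u - x 0 i : R).
  move=> x; apply: (@continuousB _ R^o _ (cst u) (fun x => x 0 i)).
    exact: cst_continuous.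
  exact: cc.
move=> x; apply: (@continuousB _ R^o _ (fun x => (a 0 0 - x 0 0) * (b 0 1 - x 0 1))
  (fun x => (a 0 1 - x 0 1) * (b 0 0 - x 0 0))); apply: continuousM; exact: cB.
Qed.

(** The three strict inequalities are open conditions by continuity of [orient], so they persist on
    a neighbourhood of [p], which therefore stays in the triangle. *)
Lemma triangle_interior (C : set (plane R)) a b c p :
  convex_set (M := plane R) C -> C a -> C b -> C c ->
  orient p a b < 0 -> orient p b c < 0 -> orient p c a < 0 -> C° p.
Proof.
move=> cC Ca Cb Cc h1 h2 h3; rewrite /interior /=.
have N u v : orient p u v < 0 -> \forall x \near p, orient x u v < 0.
  by move=> h; exact: (@orient_continuous u v p _ (lt_nbhsl h)).
move: (N _ _ h1) (N _ _ h2) (N _ _ h3) => n1 n2 n3.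
near=> x; apply: (@triangle_sub_convex C a b c) => //; near: x; assumption.
Unshelve. all: by end_near.
Qed.

Lemma convex_hullP S : convex_set (M := plane R) (convex_hull [set` S]).
Proof.
move=> x y t /set_mem xH /set_mem yH; apply/mem_set => C [cC SC].
by apply/set_mem/cC; apply/mem_set; [exact: xH | exact: yH].
Qed.

Lemma general_position_orient S a b c : general_position S ->
  a \in S -> b \in S -> c \in S -> a != b -> a != c -> b != c ->
  orient a b c != 0.
Proof.
move=> [gp _] aS bS cS ab ac bc; apply/eqP => o0.
apply: (gp [fset a; b; c]%fset).
- by apply/fsubsetP => z; rewrite !inE => /orP[/orP[]|] /eqP->.
- by rewrite -fsetUA !cardfsU1 !inE cardfs1 negb_or ab ac bc.
exists a, (b - a); split; first by rewrite subr_eq0 eq_sym.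
have D0 := lt0r_neq0 (sqr_coords_gt0 ab).
move=> z; rewrite !inE => /orP[/orP[]|] /eqP->.
- by exists 0; rewrite scale0r addr0.
- by exists 1; rewrite scale1r addrC subrK.
(* The orthogonal projection parameter of c on the line through a and b. *)
exists (((b 0 0 - a 0 0) * (c 0 0 - a 0 0) + (b 0 1 - a 0 1) * (c 0 1 - a 0 1))
  / ((b 0 0 - a 0 0) ^+ 2 + (b 0 1 - a 0 1) ^+ 2)).
(* Once the denominator is cleared, the error in each coordinate is a multiple of [orient a b c],
   which vanishes. *)
apply: row2P; rewrite !mxE; apply/eqP; rewrite addrC -subr_eq mulrAC;
  apply/eqP/(canRL (mulfK D0))/eqP; rewrite -subr_eq0; apply/eqP.
  transitivity ((a 0 1 - b 0 1) * orient a b c); last by rewrite o0 mulr0.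
  by rewrite /orient; ring.
transitivity ((b 0 0 - a 0 0) * orient a b c); last by rewrite o0 mulr0.
by rewrite /orient; ring.
Qed.

Lemma hull_point_edge S p : (1 < #|` S|)%N -> general_position S ->
  p \in S -> boundary (convex_hull [set` S]) p ->
  exists q, [/\ q \in S, p != q & forall r, r \in S -> ~~ right_of p q r].
Proof.
move=> S1 gp pS [_ pI]; apply: contrapT => noq; apply: pI.
have ex q : q \in S -> p != q -> exists2 r, r \in S & orient p q r < 0.
  move=> qS pq; apply: contrapT => H; apply: noq; exists q; split=> // r rS.
  by apply/negP => ?; apply: H; exists r.
have [a aS pa] : exists2 a, a \in S & p != a.
  have : (S `\ p)%fset != fset0.
    by rewrite -cardfs_gt0; rewrite (cardfsD1 p) pS in S1.
  by case/fset0Pn => a; rewrite !inE eq_sym => /andP[]; exists a.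
have [b0 b0S ab0] := ex a aS pa.
pose dot x :=
  (a 0 0 - p 0 0) * (x 0 0 - p 0 0) + (a 0 1 - p 0 1) * (x 0 1 - p 0 1).
(* Among the points to the right of pa, [dot / orient] is minus the cotangent of
   the clockwise angle from pa, hence increasing in that angle. *)
have [b [bS ab bmax]] : exists b, [/\ b \in S, orient p a b < 0 &
    forall r, r \in S -> orient p a r < 0 ->
      dot r / orient p a r <= dot b / orient p a b].
  have [b /= ab bmax] := @arg_maxP _ R S [` b0S]%fset
    (fun r : S => orient p a (val r) < 0)
    (fun r : S => dot (val r) / orient p a (val r)) ab0.
  exists (val b); split=> //; first exact: valP.
  by move=> r rS ar; exact: (bmax [` rS]%fset).
have pb : p != b.
  by apply: contraTN ab => /eqP <-; rewrite -leNgt /orient; lra.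
have [c cS bc] := ex b bS pb.
have ca : orient p c a < 0.
  have pc : p != c by apply: contraTN bc => /eqP <-; rewrite -leNgt /orient; lra.
  have ac : a != c.
    by apply: contraTN bc => /eqP <-; rewrite -leNgt; move: ab; rewrite /orient; lra.
  have N0 := general_position_orient gp pS aS cS pa pc ac.
  have NC : orient p c a = - orient p a c by rewrite /orient; ring.
  (* If [c] were to the right of [pa], then, being also to the right of [pb], it would come after
     [b] in the clockwise order, against the maximality of [b]. *)
  rewrite NC oppr_lt0 lt_neqAle eq_sym N0 /= leNgt; apply/negP => acl.
  have := bmax c cS acl; apply/negP; rewrite -ltNge.
  rewrite ltr_ndivrMr // mulrAC ltr_ndivrMr //.
  have : dot c * orient p a b - dot b * orient p a c =
    - orient p b c * ((a 0 0 - p 0 0) ^+ 2 + (a 0 1 - p 0 1) ^+ 2).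
    by rewrite /dot /orient; ring.
  by move=> e; have := sqr_coords_gt0 pa; nra.
have SH x : x \in S -> convex_hull [set` S] x by move=> xS C [_]; apply.
by apply: (@triangle_interior _ a b c) => //; [exact: convex_hullP | exact: SH..].
Qed.

Lemma num_hull_points_le S : (1 < #|` S|)%N -> general_position S ->
  (num_hull_points S <= num_jedges S 0)%N.
Proof.
move=> S1 gp; rewrite /num_hull_points /num_jedges.
set H := [fset p in S | _]%fset; set E := [fset l in _ | _]%fset.
(* Every hull point is the first endpoint of some 0-edge, and taking first endpoints cannot increase
   cardinality. *)
apply: leq_trans (leq_imfset_card imfset_key fst (mem E)).
apply/fsubset_leq_card/fsubsetP => p; rewrite !inE /= => /andP[pS /set_mem pb].
have [q [qS pq qr]] := hull_point_edge S1 gp pS pb.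
apply/imfsetP; exists (p, q) => //=.
rewrite !inE /= pS qS /is_jedge /= pS qS pq /= cardfs_eq0.
apply/eqP/fsetP => r; rewrite !inE /=; apply/negP => /andP[rS].
exact/negP/qr.
Qed.

End HullEdges.

(** * Counting j-edges from above *)

Lemma cardfsX (K K' : choiceType) (A : {fset K}) (B : {fset K'}) :
  #|` (A `*` B)%fset| = (#|` A| * #|` B|)%N.
Proof.
rewrite (perm_size (enum_imfset2 _ _)); first by rewrite size_allpairs.
by move=> [x y] [x' y'] _ _ [-> ->].
Qed.

Lemma sum_card_fibers_le (K : choiceType) (E : {fset K}) (f : K -> nat) m :
  (\sum_(j < m) #|` [fset x in E | f x == j]%fset| <= #|` E|)%N.
Proof.
suff -> : (\sum_(j < m) #|` [fset x in E | f x == j]%fset| =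
    #|` [fset x in E | (f x < m)%N]%fset|)%N.
  by apply/fsubset_leq_card/fsubsetP => x; rewrite !inE => /andP[].
elim: m => [|m IH].
  rewrite big_ord0; apply/esym/eqP; rewrite cardfs_eq0.
  by apply/eqP/fsetP => x; rewrite !inE ltn0 andbF.
rewrite big_ord_recr /= IH -cardfsUI.
rewrite [X in (_ + #|` X|)%N](_ : _ = fset0) ?cardfs0 ?addn0.
  congr #|` _|; apply/fsetP => x.
  by rewrite !inE -andb_orr ltnS [(f x <= m)%N]leq_eqVlt orbC.
by apply/fsetP => x; rewrite !inE; case: (x \in E) => //=; case: ltngtP.
Qed.

Lemma sum_num_jedges_le (R : realType) (S : {fset plane R}) m :
  (\sum_(j < m) num_jedges S j <= #|` S| * (#|` S| - 1))%N.
Proof.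
pose D := [fset (x, x) | x in S]%fset.
have DS : (D `<=` S `*` S)%fset.
  by apply/fsubsetP => _ /imfsetP[x /= xS ->]; rewrite !inE /= xS.
have cD : #|` D| = #|` S| by rewrite card_imfset //= => x y [].
rewrite mulnBr muln1 -[X in (_ - X)%N]cD -cardfsX -cardfsDS //.
(* Off the diagonal, an ordered pair is a [j]-edge only for [j] the number of points to its right,
   so the sets of [j]-edges lie in distinct fibers of that count. *)
apply: leq_trans (sum_card_fibers_le _
  (fun l => #|` [fset r in S | right_of l.1 l.2 r]%fset|) m).
apply: leq_sum => j _; apply/fsubset_leq_card/fsubsetP => -[x y].
rewrite !inE /= => /andP[/andP[xS yS]] /and4P[_ _ xy ->].
rewrite xS yS /= !andbT; apply: contraNN xy => /imfsetP[z _ [-> ->]].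
by rewrite eqxx.
Qed.

(** * Root moduli and the final estimate *)

(** The constant coefficient has modulus that of the leading one times the product of the root
    moduli; were all [d.+1] of these below [B], it would be too small. *)
Lemma exists_large_root (C : numClosedFieldType) (p : {poly C}) d (B : C) :
  size p = d.+2 -> 0 <= B -> B ^+ d.+1 * `|lead_coef p| <= `|p`_0| ->
  exists z, root p z /\ B <= `|z|.
Proof.
move=> sp B0; have [r pE] := closed_field_poly_normal p.
have p0 : p != 0 by rewrite -size_poly_gt0 sp.
have lp0 : lead_coef p != 0 by rewrite lead_coef_eq0.
have sr : size r = d.+1.
  by apply/eq_add_S; rewrite -sp pE size_scale // size_prod_XsubC.
have [/hasP[z zr Bz] _|/hasPn small] := boolP (has (fun z => B <= `|z|) r).
  by exists z; split=> //; rewrite pE rootZ // root_prod_XsubC.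
rewrite -horner_coef0 {2}pE hornerZ horner_prod normrM normr_prod mulrC.
rewrite ler_pM2l ?normr_gt0 // => le; exfalso; move: le; apply/negP.
have rl z : z \in r -> `|('X - z%:P).[0]| < B.
  move=> /small; rewrite hornerXsubC sub0r normrN real_ltNge //.
  exact: ger0_real.
rewrite -real_ltNge ?ger0_real ?exprn_ge0 ?prodr_ge0 //.
(* The induction starts at one root: for the empty product the strict inequality fails. *)
rewrite -sr; move: rl; case: r {pE small} sr => // z r _ rl.
elim: r z rl => [|y r IH] z rl.
  by rewrite big_seq1 expr1 rl ?mem_head.
rewrite big_cons [size _]/= exprS ltr_pM //.
- exact: prodr_ge0.
- by rewrite rl ?mem_head.
by apply: IH => x xr; apply: rl; rewrite inE xr orbT.
Qed.

(** The right side is [n (n - 1) (n - 2) / 2], and [n - 2] is at least 2. *)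
Lemma mul_pred_le_binS n : (4 <= n)%N -> (n * (n - 1) <= 3 * 'C(n, 3))%N.
Proof.
case: n => [|[|[|[|n]]]] // _.
have := bin_ffact n.+4 3; rewrite !ffactnS ffactn0 /=.
change (3`!)%N with 6%N.
nia.
Qed.

Theorem theorem18 (R : realType) (n h : nat) (S : {fset plane R})
  (hn : (4 <= n)%N) (hS : #|` S| = n) (hgen : general_position S)
  (hh : num_hull_points S = h) :
  exists z : R[i], root (edge_poly S) z /\
    (((3 * 'C(n, 3))%:R / h%:R) `^ (- (1 / (n - 3)%:R)))%:C <= `|z|.
Proof.
set M := (3 * 'C(n, 3))%N; set B := _ `^ _.
have hE0 : (h <= num_le_kedges S 0)%N.
  rewrite -hh /num_le_kedges big_ord1 num_hull_points_le // hS.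
  exact: leq_trans hn.
have EM : (num_le_kedges S (n - 3) <= M)%N.
  apply: leq_trans (sum_num_jedges_le _ _) _.
  by rewrite hS mul_pred_le_binS.
have E0E : (num_le_kedges S 0 <= num_le_kedges S (n - 3))%N.
  by rewrite /num_le_kedges big_ord1 big_ord_recl leq_addr.
(* If the top coefficient is 0, monotonicity in [k] makes all coefficients 0, and every number, in
   particular [B], is a root. *)
have [E0|En0] := eqVneq (num_le_kedges S (n - 3)) 0%N.
  have pE0 : edge_poly S = 0.
    apply/polyP => k; rewrite coef_poly coef0 hS; case: ltnP => // kn.
    suff -> : num_le_kedges S k = 0%N by [].
    apply/eqP; rewrite -leqn0 -E0 /num_le_kedges.
    rewrite -!(big_mkord xpredT) (big_cat_nat (n := k.+1) (p := (n - 3).+1)) //=.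
    exact: leq_addr.
  exists B%:C; rewrite pE0 root0; split=> //.
  by rewrite ger0_norm // lecR powR_ge0.
have d1 : (n - 3 = (n - 4).+1)%N by lia.
have sz : size (edge_poly S) = (n - 4).+2.
  by rewrite /edge_poly hS size_poly_eq ?d1 // -d1 pnatr_eq0.
apply: (exists_large_root sz); first by rewrite lecR powR_ge0.
rewrite lead_coefE sz /= /edge_poly !coef_poly hS -d1 ltnSn /= !normr_nat.
(* For [h = 0] the quotient is 0 by the convention on division by zero, and so is its power with
   nonzero exponent; thus [B = 0]. *)
have [h0|hpos] := posnP h.
  rewrite /B h0 invr0 mulr0 powR0.
    by rewrite rmorph0 expr0n d1 mul0r ler0n.
  by rewrite oppr_eq0 div1r invr_eq0 pnatr_eq0 d1.
have Mpos : (0 < M)%N by apply: leq_trans hpos (leq_trans hE0 (leq_trans E0E EM)).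
have -> : B%:C ^+ (n - 3) = (h%:R / M%:R : R)%:C.
  rewrite -rmorphXn /=; congr _%:C.
  rewrite -powR_mulrn ?powR_ge0 // -powRrM div1r mulNr mulVf ?pnatr_eq0 ?d1 //.
  by rewrite powR_inv1 ?invf_div // divr_ge0 ?ler0n.
rewrite -!(rmorph_nat (real_complex R)) -rmorphM lecR.
(* After clearing [M], the claim is the product of the bounds [hE0] and [EM]. *)
rewrite mulrAC ler_pdivrMr ?ltr0n // -!natrM ler_nat leq_mul //.
Qed.
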